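(* Let $n,d,u,c\ge 0$ be integers with $d+c+2u+3\le n$. Consider repositories with $n$ packages and no known dependencies ($K=\emptyset$), with at most $d$ defects ($|D|\le d$), at most $u$ unknown dependencies ($|U|\le u$), and at most $c$ conflicts ($|C|\le c$). There exists a non-adaptive algorithm that solves Full Learning on all such repositories using $\mathcal S_{n,d+c+u+1,u+2}$ queries.
   Context: A repository consists of a finite set $P$ of $n$ packages, a set $K\subseteq P\times P$ of known dependencies, a set $U\subseteq P\times P$ of unknown dependencies, a set $C$ of unknown conflicts (unordered pairs of distinct packages), and a set $D\subseteq P$ of defects. A dependency $(q,p)\in K\cup U$ means that $q$ depends on $p$. An installation is a subset $I\subseteq P$; it is successful iff (i) $I\cap D=\emptyset$, (ii) for every $(q,p)\in K\cup U$, $q\in I$ implies $p\in I$, and (iii) no $\{p,q\}\in C$ satisfies $p,q\in I$. A defect is a package contained in no successful installation, and $D$ is the set of all defects (so every package outside $D$ lies in some successful installation; in particular a package that depends on a defect, or on two conflicting packages, is a defect). Two packages $p,q$ weakly conflict if no successful installation includes both $p$ and $q$; $p$ weakly depends on $q$ if no successful installation includes $p$ but not $q$. An algorithm is given $P$, $K$ and the bounds $d,u,c$. A query is an installation $I\subseteq P$; the oracle answers whether $I$ is successful. A non-adaptive algorithm fixes its whole set of queries from its input alone, then computes its output from the answers. Local computation is free; the cost is the number of queries. ''Using $q$ queries'' means at most $q$ queries on every input. Full Learning (conflicts and dependencies understood in the weak sense): determine the set $D$ of defects, the set of all pairs of packages that weakly conflict, and the set of all ordered pairs $(p,q)$ such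 that $p$ weakly depends on $q$. For $a,b\ge 0$ with $a+b\le n$, an $(n,a,b)$-cover-free family (CFF) is a set $\mathcal F\subseteq\{0,1\}^n$ such that for all disjoint $S_1,S_2\subseteq\{1,\dots,n\}$ with $|S_1|=a$, $|S_2|=b$ there is $v\in\mathcal F$ with $v_i=0$ for all $i\in S_1$ and $v_i=1$ for all $i\in S_2$. $\mathcal S_{n,a,b}$ denotes the minimal size of an $(n,a,b)$-CFF. *)

(* Defs.v *)
From mathcomp Require Import all_boot.

Set Implicit Arguments.
Unset Strict Implicit.
Unset Printing Implicit Defensive.

(** * Repositories *)

(** A pair [(q, p)] in [K :|: U] means that [q] depends on [p]; an element [e]
    of [C] is an unordered pair, so [e \subset X] says that both conflicting
    packages are installed. *)
Definition success (P : finType) (K U : {set P * P}) (C : {set {set P}})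
    (D X : {set P}) : bool :=
  [&& [disjoint X & D],
      [forall e in K :|: U, (e.1 \in X) ==> (e.2 \in X)]
    & [forall e in C, ~~ (e \subset X)]].

(** Success refers to the defects and the defects refer to success: the field
    [defectsP] is this mutual constraint.  It does not determine [defects] from
    the other data, as a package may be a defect for no other reason. *)
Record repository (P : finType) := Repository {
  known : {set P * P};
  unknown : {set P * P};
  conflicts : {set {set P}};
  defects : {set P};
  conflictsP : forall e : {set P}, e \in conflicts -> #|e| = 2;
  defectsP : forall p : P, p \in defects <->
    ~ (exists X : {set P}, success known unknown conflicts defects X /\ p \in X)
}.

Definition successful (P : finType) (R : repository P) (X : {set P}) : bool :=
  success (known R) (unknown R) (conflicts R) (defects R) X.

Definition weakly_conflict (P : finType) (R : repository P) (p q : P) : bool :=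
  ~~ [exists X : {set P}, [&& successful R X, p \in X & q \in X]].

Definition weakly_depends (P : finType) (R : repository P) (p q : P) : bool :=
  ~~ [exists X : {set P}, [&& successful R X, p \in X & q \notin X]].

Definition weak_conflicts (P : finType) (R : repository P) : {set {set P}} :=
  [set [set pq.1; pq.2] | pq : P * P
     & (pq.1 != pq.2) && weakly_conflict R pq.1 pq.2].

Definition weak_dependencies (P : finType) (R : repository P) : {set P * P} :=
  [set pq | weakly_depends R pq.1 pq.2].

(** * Non-adaptive algorithms *)

Definition full_learning_output (P : finType) : Type :=
  ({set P} * {set {set P}} * {set P * P})%type.

Definition full_learning (P : finType) (R : repository P) :
    full_learning_output P :=
  (defects R, weak_conflicts R, weak_dependencies R).

(** The [i]-th bit passed to [output] is the oracle's answer to the [i]-th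
    query. *)
Record protocol (P : finType) := Protocol {
  queries : seq {set P};
  output : bitseq -> full_learning_output P
}.

(** The arguments are the known dependencies and the bounds on the numbers of
    defects, unknown dependencies and conflicts, in this order. *)
Definition nonadaptive_algorithm (P : finType) : Type :=
  {set P * P} -> nat -> nat -> nat -> protocol P.

Definition run (P : finType) (A : nonadaptive_algorithm P) (d u c : nat)
    (R : repository P) : full_learning_output P :=
  let pr := A (known R) d u c in
  output pr [seq successful R X | X <- queries pr].

(** * Cover-free families *)

Definition cover_free (n a b : nat) (F : {set {ffun 'I_n -> bool}}) : bool :=
  [forall S1 : {set 'I_n}, forall S2 : {set 'I_n},
    [&& [disjoint S1 & S2], #|S1| == a & #|S2| == b] ==>
    [exists v in F, [forall i in S1, v i == false]
                    && [forall i in S2, v i == true]]].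

Lemma cover_free_setT (n a b : nat) :
  cover_free a b [set: {ffun 'I_n -> bool}].
Proof.
apply/forallP=> S1; apply/forallP=> S2; apply/implyP=> /and3P[dis _ _].
apply/existsP; exists [ffun i => i \in S2]; rewrite inE /=; apply/andP; split.
- by apply/forallP=> i; apply/implyP=> iS1; rewrite ffunE (disjointFr dis).
- by apply/forallP=> i; apply/implyP=> iS2; rewrite ffunE iS2.
Qed.

Definition min_cover_free (n a b : nat) : nat :=
  #|[arg min_(F < [set: {ffun 'I_n -> bool}] | cover_free a b F) #|F|]|.

Lemma min_cover_freeP (n a b : nat) :
  (exists2 F : {set {ffun 'I_n -> bool}},
     cover_free a b F & #|F| = min_cover_free n a b)
  /\ (forall F : {set {ffun 'I_n -> bool}},
        cover_free a b F -> min_cover_free n a b <= #|F|).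
Proof.
rewrite /min_cover_free; case: arg_minnP => [|F cF minF].
  exact: cover_free_setT.
by split=> //; exists F.
Qed.

(* Main.v *)
Require Import Defs.
From mathcomp Require Import all_boot.

(** Query the members of a minimal cover-free family, read as sets of packages.
    If a successful installation [X] contains [A] and avoids [B], let [Z] be the
    set of packages of [X] that lie in [A] or are targets of unknown
    dependencies.  Then [Z] is closed under dependencies, and an installation
    containing [Z] is successful as soon as it avoids the defects, one package
    outside [Z] from every conflict, and every source of a dependency outside
    [Z].  The family has a member that contains [Z] and avoids all of these and
    [B].  Taking [A = {p, q}], [B = {}] and [A = {p}], [B = {q}], the successful
    queries alone witness every failure of a weak conflict or of a weak
    dependency. *)

Set Implicit Arguments.
Unset Strict Implicit.
Unset Printing Implicit Defensive.

Lemma subset_between_card (T : finType) (S W : {set T}) (k : nat) :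
  S \subset W -> #|S| <= k <= #|W| ->
  exists V : {set T}, [/\ S \subset V, V \subset W & #|V| = k].
Proof.
move=> sSW /andP[]; elim: k => [|k IHk] leSk lekW.
  by exists S; split=> //; apply/eqP; rewrite -leqn0.
move: leSk; rewrite leq_eqVlt => /orP[/eqP cS | leSk]; first by exists S.
have [V [sSV sVW cV]] := IHk leSk (ltnW lekW).
have /subsetPn[x Wx V'x] : ~~ (W \subset V).
  by apply: contraL lekW => /subset_leq_card; rewrite cV ltnNge negbK.
exists (x |: V); split; last by rewrite cardsU1 V'x cV.
  exact: subset_trans sSV (subsetUr _ _).
by rewrite subUset sub1set Wx.
Qed.

(** Cover-freeness concerns sets of exact sizes; padding makes it usable for smaller ones, and
    [a + b <= #|T|] leaves the room. *)
Lemma disjoint_extension (T : finType) (S1 S2 : {set T}) (a b : nat) :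
  [disjoint S1 & S2] -> #|S1| <= a -> #|S2| <= b -> a + b <= #|T| ->
  exists T1 T2 : {set T},
    [/\ S1 \subset T1, S2 \subset T2, [disjoint T1 & T2], #|T1| = a & #|T2| = b].
Proof.
move=> dS leS1 leS2 leab.
have [||T1 [sS1 sT1 cT1]] := @subset_between_card _ S1 (~: S2) a.
- by rewrite -disjoints_subset.
- rewrite leS1 -(leq_add2l #|S2|) cardsC addnC.
  by apply: leq_trans leab; rewrite leq_add2l.
have [||T2 [sS2 sT2 cT2]] := @subset_between_card _ S2 (~: T1) b.
- by rewrite subsetC.
- by rewrite leS2 -(leq_add2l #|T1|) cardsC cT1.
by exists T1, T2; split=> //; rewrite disjoints_subset subsetC.
Qed.

Definition cff_queries (P : finType) (F : {set {ffun 'I_#|P| -> bool}}) :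
    seq {set P} :=
  [seq [set p | v (enum_rank p)] | v : {ffun 'I_#|P| -> bool} in F].

Lemma cff_queriesP (P : finType) (F : {set {ffun 'I_#|P| -> bool}}) (a b : nat)
    (S1 S2 : {set P}) :
  cover_free a b F -> a + b <= #|P| ->
  [disjoint S1 & S2] -> #|S1| <= a -> #|S2| <= b ->
  exists2 Y, Y \in cff_queries F & [disjoint Y & S1] /\ S2 \subset Y.
Proof.
move=> cF leab dS leS1 leS2.
have [T1 [T2 [sT1 sT2 dT cT1 cT2]]] := disjoint_extension dS leS1 leS2 leab.
have inj := @enum_rank_inj P.
move/forallP/(_ (enum_rank @: T1))/forallP/(_ (enum_rank @: T2))/implyP: cF.
rewrite !card_imset // cT1 cT2 !eqxx (imset_disjoint inj) dT => /(_ isT).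
move=> /existsP[v /and3P[Fv /forallP v1 /forallP v2]].
exists [set p | v (enum_rank p)]; first by apply: image_f.
split.
  rewrite disjoint_sym disjoints_subset; apply/subsetP=> p /(subsetP sT1) T1p.
  by rewrite !inE (eqP (implyP (v1 _) (imset_f _ T1p))).
apply/subsetP=> p /(subsetP sT2) T2p.
by rewrite inE (eqP (implyP (v2 _) (imset_f _ T2p))).
Qed.

Lemma hitting_set (T : finType) (x0 : T) (C : {set {set T}}) (Z : {set T}) :
  (forall e, e \in C -> ~~ (e \subset Z)) ->
  exists H : {set T}, [/\ #|H| <= #|C|, [disjoint H & Z] &
    forall e, e \in C -> exists2 x, x \in e & x \in H].
Proof.
move=> CZ.
have /fin_all_exists[f fP] (e : {set T}) :
    exists x, e \in C -> (x \in e) && (x \notin Z).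
  (* Outside [C] the choice function takes the default value [x0]. *)
  have [/CZ/subsetPn[x ex Zx]|] := boolP (e \in C); last by exists x0.
  by exists x; rewrite ex Zx.
exists (f @: C); split; first exact: leq_imset_card.
  rewrite disjoints_subset; apply/subsetP=> _ /imsetP[e /fP/andP[_ Z'fe] ->].
  by rewrite inE.
by move=> e Ce; exists (f e); [case/andP: (fP e Ce) | apply: imset_f].
Qed.

(** The bounds count, for [S1], the defects, one package per conflict, one source per dependency and
    [B]; for [S2], one target per dependency and [A]. Neither depends on the size of [X]. *)
Lemma successful_window (P : finType) (R : repository P) (x0 : P)
    (X A B : {set P}) :
  known R = set0 -> successful R X -> A \subset X -> [disjoint X & B] ->
  exists S1 S2 : {set P}, [/\ [disjoint S1 & S2],
    #|S1| <= #|defects R| + #|conflicts R| + #|unknown R| + #|B|,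
    #|S2| <= #|unknown R| + #|A|, (A \subset S2) && (B \subset S1) &
    forall Y : {set P}, [disjoint Y & S1] -> S2 \subset Y -> successful R Y].
Proof.
rewrite /successful /success => -> /and3P[dXD /forallP depX /forallP confX].
move=> sAX dXB.
set U := unknown R in depX *.
pose Z := X :&: ([set e.2 | e in U] :|: A).
have sZX : Z \subset X by apply: subsetIl.
have [e Ce|H [leH dHZ hitH]] := hitting_set x0 (C := conflicts R) (Z := Z).
  by apply: contra (implyP (confX e) Ce) => /subset_trans; apply.
(* Sources inside [Z] are kept out of [S1], which must be disjoint from [Z]; their targets lie in
   [Z] already. *)
pose S1 := defects R :|: H :|: ([set e.1 | e in U] :\: Z) :|: B.
exists S1, Z; split.
- rewrite /S1 disjoints_subset !subUset -!disjoints_subset dHZ -!andbA.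
  apply/and4P; split=> //.
  + by rewrite disjoint_sym; apply: disjointWl sZX dXD.
  + by rewrite disjoints_subset setDE subsetIr.
  + by rewrite disjoint_sym; apply: disjointWl sZX dXB.
- rewrite /S1 (leq_trans (leq_card_setU _ _)) // leq_add2r.
  apply: leq_trans (leq_card_setU _ _) _; apply: leq_add.
    by apply: leq_trans (leq_card_setU _ _) _; rewrite leq_add2l.
  exact: leq_trans (subset_leq_card (subsetDl _ _)) (leq_imset_card _ _).
- apply: leq_trans (subset_leq_card (subsetIr _ _)) _.
  by apply: leq_trans (leq_card_setU _ _) _; rewrite leq_add2r leq_imset_card.
- by rewrite subsetI sAX subsetUr subsetUr.
move=> Y dYS sZY; apply/and3P; split.
- by apply: disjointWr dYS; rewrite /S1 -!setUA subsetUl.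
- apply/forallP=> e; apply/implyP=> Ue; apply/implyP=> Ye1.
  have Ue' : e \in U by rewrite set0U in Ue.
  (* A source in [Y] but outside [Z] would belong to [S1]. *)
  have Ze1 : e.1 \in Z.
    move/disjointFr: dYS => /(_ _ Ye1); apply: contraFT => Z'e1.
    by rewrite /S1 in_setU in_setU in_setD Z'e1 imset_f ?orbT.
  (* The target of [e] is in [X] because [X] is closed, so it is in [Z]. *)
  apply: (subsetP sZY); rewrite inE in_setU imset_f // andbT.
  exact: implyP (implyP (depX e) Ue) (subsetP sZX _ Ze1).
apply/forallP=> e; apply/implyP=> Ce; have [x ex Hx] := hitH e Ce.
apply/negP=> /subsetP/(_ x ex) Yx; have := disjointFr dYS Yx.
by rewrite /S1 !in_setU Hx orbT.
Qed.

(** With [s] the successful queries, every defect, conflict and dependency is presumed until a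
    member of [s] refutes it. *)
Definition learn (P : finType) (s : seq {set P}) : full_learning_output P :=
  ([set p | ~~ has (fun X : {set P} => p \in X) s],
   [set [set pq.1; pq.2] | pq : P * P
     & (pq.1 != pq.2)
       && ~~ has (fun X : {set P} => (pq.1 \in X) && (pq.2 \in X)) s],
   [set pq | ~~ has (fun X : {set P} => (pq.1 \in X) && (pq.2 \notin X)) s]).

(** Masking the queries by the oracle's answers leaves exactly the successful ones. *)
Definition learner (P : finType) (s : seq {set P}) : protocol P :=
  Protocol s (fun bits => learn (mask bits s)).

Lemma has_successful (P : finType) (R : repository P) (s : seq {set P})
    (Q : pred {set P}) :
  ((exists X, successful R X && Q X) ->
    exists2 Y, Y \in s & successful R Y && Q Y) ->
  has Q [seq X <- s | successful R X] = [exists X, successful R X && Q X].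
Proof.
move=> sQ; apply/hasP/existsP => [[X]|/sQ[Y sY /andP[RY QY]]].
  by rewrite mem_filter => /andP[RX _] QX; exists X; rewrite RX.
by exists Y; rewrite ?mem_filter ?RY.
Qed.

Lemma learn_successful (P : finType) (R : repository P) (s : seq {set P}) :
  (forall p q, (exists X, successful R X && ((p \in X) && (q \in X))) ->
     exists2 Y, Y \in s & successful R Y && ((p \in Y) && (q \in Y))) ->
  (forall p q, (exists X, successful R X && ((p \in X) && (q \notin X))) ->
     exists2 Y, Y \in s & successful R Y && ((p \in Y) && (q \notin Y))) ->
  learn [seq X <- s | successful R X] = full_learning R.
Proof.
move=> both one; congr (_, _, _).
- apply/setP=> p; rewrite inE.
  (* A defect is a package in weak conflict with itself, so the hypothesis on pairs applies with
     [q = p]. *)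
  under eq_has do rewrite -[_ \in _]andbb.
  rewrite has_successful; last exact: both.
  apply/idP/idP=> [nX | Dp].
    apply/defectsP=> -[X [RX Xp]]; case/existsP: nX; exists X.
    by rewrite Xp /successful RX.
  apply/existsP=> -[X /andP[RX /andP[Xp _]]].
  by move/defectsP: Dp; apply; exists X.
- have hasE pq := has_successful (both pq.1 pq.2).
  by apply/setP=> e; apply/imsetP/imsetP=> -[pq]; rewrite inE => pqP ->;
    exists pq; rewrite // inE; move: pqP; rewrite hasE.
- apply/setP=> pq; rewrite !inE; congr (~~ _).
  by rewrite has_successful //; apply: one.
Qed.

Theorem corollary1 (n d u c : nat) (hn : d + c + 2 * u + 3 <= n)
    (P : finType) (hP : #|P| = n) :
  exists A : nonadaptive_algorithm P,
    size (queries (A set0 d u c)) <= min_cover_free n (d + c + u + 1) (u + 2)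
    /\ forall R : repository P,
         known R = set0 ->
         #|defects R| <= d -> #|unknown R| <= u -> #|conflicts R| <= c ->
         run A d u c R = full_learning R.
Proof.
subst n; have [[F cF <-] _] := min_cover_freeP #|P| (d + c + u + 1) (u + 2).
exists (fun _ _ _ _ => learner (cff_queries F)).
split=> [|R K0 leD leU leC]; first by rewrite size_image.
(* The two parameters sum to [d + c + 2 * u + 3], the left side of [hn]. *)
have leP : d + c + u + 1 + (u + 2) <= #|P|.
  by move: hn; rewrite mul2n -addnn -!addnA (addnCA 1 u).
(* The bounds 2 on [A] and 1 on [B] account for the summands 2 and 1 in the parameters of the
   family. *)
have witness (p : P) (X A B : {set P}) : #|A| <= 2 -> #|B| <= 1 ->
    successful R X -> A \subset X -> [disjoint X & B] ->
    exists2 Y, Y \in cff_queries F &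
      [/\ successful R Y, A \subset Y & [disjoint Y & B]].
  move=> leA leB RX sAX dXB.
  have [S1 [S2 [dS leS1 leS2 /andP[sA sB] RS]]] :=
    successful_window p K0 RX sAX dXB.
  have [||Y FY [dYS sSY]] := cff_queriesP cF leP dS.
  - by apply: leq_trans leS1 _; rewrite !leq_add.
  - by apply: leq_trans leS2 _; rewrite leq_add.
  by exists Y => //; split; [exact: RS | exact: subset_trans sA sSY
                            | exact: disjointWr sB dYS].
rewrite /run /= -filter_mask; apply: learn_successful => p q.
  case=> X /and3P[RX Xp Xq].
  have [|||||Y FY [RY sY _]] := witness p X [set p; q] set0.
  (* The case [p = q], which decides the defects, is included. *)
  - by rewrite cards2; case: eqP.
  - by rewrite cards0.
  - by [].
  - by rewrite subUset !sub1set Xp.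
  - by rewrite disjoint_sym disjoints_subset sub0set.
  by exists Y => //; move: sY; rewrite RY subUset !sub1set.
case=> X /and3P[RX Xp X'q].
have [|||||Y FY [RY sY dY]] := witness p X [set p] [set q].
- by rewrite cards1.
- by rewrite cards1.
- by [].
- by rewrite sub1set.
- by rewrite disjoint_sym disjoints1.
exists Y => //; move: sY dY; rewrite RY sub1set disjoint_sym disjoints1 => ->.
by [].
Qed.
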